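(* Let $\kappa:\mathcal C_2\to\mathbb R$ be a generalized Gini's gamma. Then there exists a unique Borel probability measure $\nu$ on $\left(0,\tfrac12\right]$ such that $\kappa=\gamma_\nu$, where for every $C\in\mathcal C_2$ and $(U,V)\sim C$, $$\gamma_\nu(C)=\int_{\left(0,\frac12\right]}\rho\big(G^{-1}(U;p),G^{-1}(V;p)\big)\,\mathrm d\nu(p).$$ Here $G(x;p)=p\,\mathbf 1_{\{x\ge -1\}}+(1-2p)\,\mathbf 1_{\{x\ge 0\}}+p\,\mathbf 1_{\{x\ge 1\}}$, $x\in\mathbb R$, and $G^{-1}(\cdot;p)$ is its quantile function.
   Context: A (bivariate) copula is a distribution function $C:[0,1]^2\to[0,1]$ with standard uniform univariate margins; $\mathcal C_2$ is the set of all bivariate copulas. $(U,V)\sim C$ means that $(U,V)$ is a random vector with distribution function $C$. $M(u,v)=\min(u,v)$ and $\Pi(u,v)=uv$. $\rho$ is Pearson's correlation coefficient. The quantile function of a distribution function $G$ is $G^{-1}(u)=\inf\{x\in\mathbb R:G(x)\ge u\}$, $u\in(0,1)$. Let $\mathcal D_4=\{e,\tau,\sigma_1,\sigma_2,\tau\sigma_1,\tau\sigma_2,\sigma_1\sigma_2,\tau\sigma_1\sigma_2\}$ be the group of symmetries of $(0,1)^2$ with $e(u,v)=(u,v)$, $\sigma_1(u,v)=(1-u,v)$, $\sigma_2(u,v)=(u,1-v)$, $\tau(u,v)=(v,u)$. $\mathcal M$ is the set of admissible $D_4$-invariant measures: Borel measures $\mu$ on $(0,1)^2$ such that $\mu(\xi(A))=\mu(A)$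 for all $\xi\in\mathcal D_4$ and Borel $A\subseteq(0,1)^2$, and $0<\int_{(0,1)^2}(M-\Pi)\,\mathrm d\mu<\infty$. A generalized Gini's gamma is a map $\kappa:\mathcal C_2\to\mathbb R$ (a measure of concordance) of the form $$\kappa(C)=\frac{\int_{(0,1)^2}(C-\Pi)\,\mathrm d\mu}{\int_{(0,1)^2}(M-\Pi)\,\mathrm d\mu},\quad C\in\mathcal C_2,$$ for some $\mu\in\mathcal M$ whose mass is concentrated on $\{(u,v)\in(0,1)^2: u=v\text{ or }u+v=1\}$. Here a measure of concordance is a map $\kappa:\mathcal C_2\to\mathbb R$ such that, writing $\kappa(U,V)$ for $\kappa(C)$ when $(U,V)\sim C$: (1) $\kappa(M)=1$; (2) $\kappa(V,U)=\kappa(U,V)$; (3) $\kappa(U,1-V)=-\kappa(U,V)$; (4) $\kappa(C)\le\kappa(C')$ if $C\le C'$ pointwise; (5) $\kappa(C_n)\to\kappa(C)$ if $C_n\to C$ pointwise. *)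

(* Defs.v *)
From HB Require Import structures.
From mathcomp Require Import all_boot all_order all_algebra.
From mathcomp Require Import all_classical all_reals all_analysis.

Set Implicit Arguments.
Unset Strict Implicit.
Unset Printing Implicit Defensive.

Import Order.TTheory GRing.Theory Num.Theory.
Import numFieldNormedType.Exports.

Local Open Scope classical_set_scope.
Local Open Scope ring_scope.

(* A copula is carried by its canonical extension to R^2, i.e. the joint
   distribution function of a probability measure on R^2 with standard uniform
   margins.  It is determined by its restriction to [0, 1]^2, so Leibniz
   equality of the underlying functions is equality of copulas. *)
Definition is_copula (R : realType) (C : R -> R -> R) : Prop :=
  exists P : probability (R * R)%type R,
    [/\ forall u v : R, (C u v)%:E = P [set x | x.1 <= u /\ x.2 <= v],
        forall u : R, 0 <= u <= 1 -> P [set x | x.1 <= u] = u%:E &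
        forall v : R, 0 <= v <= 1 -> P [set x | x.2 <= v] = v%:E].

Record copula (R : realType) : Type := Copula {
  copula_fun :> R -> R -> R;
  copulaP : is_copula copula_fun }.

Definition copM {R : realType} (u v : R) : R := Num.min u v.
Definition copPi {R : realType} (u v : R) : R := u * v.

(* (U, V) is a random vector on (T, P) with distribution function C *)
Definition has_copula (d : measure_display) (T : measurableType d)
    (R : realType) (P : probability T R) (U V : T -> R)
    (C : copula R) : Prop :=
  [/\ measurable_fun setT U, measurable_fun setT V &
      forall u v : R, P [set w | U w <= u /\ V w <= v] = (C u v)%:E].

(* The minimum copula is given by [copM] on [0, 1]^2 only, whence the range of
   [u] and [v] in the first clause. *)
Record concordance_measure (R : realType) (kappa : copula R -> R) : Prop := {
  concordance_M : forall C : copula R,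
    (forall u v : R, 0 <= u <= 1 -> 0 <= v <= 1 -> C u v = copM u v) ->
    kappa C = 1;
  concordance_sym : forall (d : measure_display) (T : measurableType d)
      (P : probability T R) (U V : T -> R) (C C' : copula R),
    has_copula P U V C -> has_copula P V U C' -> kappa C' = kappa C;
  concordance_refl : forall (d : measure_display) (T : measurableType d)
      (P : probability T R) (U V : T -> R) (C C' : copula R),
    has_copula P U V C -> has_copula P U (fun w => 1 - V w) C' ->
    kappa C' = - kappa C;
  concordance_le : forall C C' : copula R,
    (forall u v : R, 0 <= u <= 1 -> 0 <= v <= 1 -> C u v <= C' u v) ->
    kappa C <= kappa C';
  concordance_cvg : forall (Cn : nat -> copula R) (C : copula R),
    (forall u v : R, 0 <= u <= 1 -> 0 <= v <= 1 ->
      (fun n => Cn n u v) @ \oo --> C u v) ->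
    (fun n => kappa (Cn n)) @ \oo --> kappa C }.

Definition unit_square {R : realType} : set (R * R) :=
  [set x | 0 < x.1 < 1 /\ 0 < x.2 < 1].

Definition sym_tau {R : realType} (x : R * R) : R * R := (x.2, x.1).
Definition sym_sigma1 {R : realType} (x : R * R) : R * R := (1 - x.1, x.2).
Definition sym_sigma2 {R : realType} (x : R * R) : R * R := (x.1, 1 - x.2).

Definition D4 {R : realType} : set (R * R -> R * R) :=
  [set id; sym_tau; sym_sigma1; sym_sigma2; sym_tau \o sym_sigma1;
    sym_tau \o sym_sigma2; sym_sigma1 \o sym_sigma2;
    sym_tau \o sym_sigma1 \o sym_sigma2].

(* A Borel measure on (0, 1)^2 is a measure on R^2 carried by (0, 1)^2. *)
Definition admissible (R : realType)
    (mu : {measure set (R * R)%type -> \bar R}) : Prop :=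
  [/\ mu (~` unit_square) = 0%E,
      forall xi : R * R -> R * R, D4 xi -> forall A : set (R * R),
        measurable A -> A `<=` unit_square -> mu (xi @` A) = mu A &
      (0 < \int[mu]_(x in unit_square)
             (copM x.1 x.2 - copPi x.1 x.2)%:E < +oo)%E].

Definition diagonals {R : realType} : set (R * R) :=
  [set x | x.1 = x.2 \/ x.1 + x.2 = 1].

Definition generalized_gini (R : realType) (kappa : copula R -> R) : Prop :=
  concordance_measure kappa /\
  exists mu : {measure set (R * R)%type -> \bar R},
    [/\ admissible mu,
        mu (unit_square `\` diagonals) = 0%E &
        forall C : copula R, kappa C =
          (\int[mu]_(x in unit_square) (C x.1 x.2 - copPi x.1 x.2)) /
          (\int[mu]_(x in unit_square) (copM x.1 x.2 - copPi x.1 x.2))].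

(* Only meaningful for 0 < u < 1; a uniform variable lies outside (0, 1)
   with probability zero. *)
Definition quantile (R : realType) (F : R -> R) (u : R) : R :=
  inf [set x | u <= F x].

Definition Gdist {R : realType} (p x : R) : R :=
  p * \1_`[-1, +oo[ x + (1 - 2 * p) * \1_`[0, +oo[ x + p * \1_`[1, +oo[ x.

Definition pearson (d : measure_display) (T : measurableType d)
    (R : realType) (P : probability T R) (X Y : T -> R) : R :=
  fine (covariance P X Y) /
    (Num.sqrt (fine 'V_P[X]) * Num.sqrt (fine 'V_P[Y])).

Definition half_itv {R : realType} : set R := `]0, 2^-1].

Definition gamma_at (R : realType) (nu : probability R R)
    (d : measure_display) (T : measurableType d) (P : probability T R)
    (U V : T -> R) : R :=
  \int[nu]_(p in half_itv) pearson P (quantile (Gdist p) \o U)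
                                       (quantile (Gdist p) \o V).

(* [nu] is a Borel probability measure on (0, 1/2] (i.e. a probability measure
   on R carried by that interval) and kappa = gamma_nu. *)
Definition gamma_represents (R : realType) (nu : probability R R)
    (kappa : copula R -> R) : Prop :=
  nu half_itv = 1%E /\
  forall (C : copula R) (d : measure_display) (T : measurableType d)
    (P : probability T R) (U V : T -> R),
    has_copula P U V C -> kappa C = gamma_at nu P U V.

(* Main.v *)
From HB Require Import structures.
Require Import Defs.
From mathcomp Require Import all_boot all_order all_algebra.
From mathcomp Require Import all_classical all_reals all_analysis.
From mathcomp Require Import measurable_realfun ring lra.

(* Write w(x) for the distance of x.1 to {0, 1} and
   S(p) = C(p,p) + C(1-p,1-p) + C(p,1-p) + C(1-p,p).  For (U, V) ~ C the
   three-point variables G^-1(U; p), G^-1(V; p) are centred with variance 2p and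
   covariance S(p) - 1, so their correlation is (S(p) - 1) / (2p).
   Existence: on the diagonals the orbit of x under the reflections consists of
   the four corners counted by S(w(x)), whence D4-invariance gives
   4 int (C - Pi) dmu = int (S(w) - 1) dmu and 2 int (M - Pi) dmu = int w dmu;
   nu is the image under w of the measure w dmu / int w dmu.
   Uniqueness: if V = 1 - U for a < U < 1 - a and V = U otherwise, then the
   correlation at p is 2 min(p, a) / p - 1.  Combining the values for a < b
   yields a function squeezed between the indicators of (0, a] and (0, b], so
   the distribution functions of two representing measures interlace. *)

Set Implicit Arguments.
Unset Strict Implicit.
Unset Printing Implicit Defensive.

Import Order.TTheory GRing.Theory Num.Theory.
Import numFieldNormedType.Exports.

Local Open Scope classical_set_scope.
Local Open Scope ring_scope.

(** * Measures with a density *)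

Section density.
Context d (T : measurableType d) (R : realType).
Variables (mu : {measure set T -> \bar R}) (f : T -> R).
Hypotheses (mf : measurable_fun setT f) (f0 : forall x, 0 <= f x).

(** The two proofs are arguments so that the measure structure below, whose axioms depend on them,
    can be inferred from the term [density mf f0]. *)
Definition density (_ : measurable_fun setT f) (_ : forall x, 0 <= f x)
  (A : set T) : \bar R := (\int[mu]_(x in A) (f x)%:E)%E.

Local Notation fmu := (density mf f0).

Let density0 : fmu set0 = 0%E.
Proof. exact: integral_set0. Qed.

Let density_ge0 A : (0 <= fmu A)%E.
Proof. by apply: integral_ge0 => x _; rewrite lee_fin. Qed.

Let density_sigma_additive : semi_sigma_additive fmu.
Proof.
move=> F mF tF mUF; rewrite /density; apply: cvg_toP.
  apply: ereal_nondecreasing_is_cvgn => m n mn.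
  apply: lee_sum_nneg_natr => // k _ _.
  by apply: integral_ge0 => x _; rewrite lee_fin.
rewrite ge0_integral_bigcup//.
  by apply/measurable_EFinP; exact: measurable_funTS.
by move=> x _; rewrite lee_fin.
Qed.

HB.instance Definition _ := isMeasure.Build _ _ _ fmu
  density0 density_ge0 density_sigma_additive.

Import HBNNSimple.

(** Simple functions approximate [g] from below: for each of them the identity is linearity together
    with the definition of [density], and monotone convergence on both sides passes to the limit. *)
Lemma ge0_integral_density (g : T -> \bar R) :
  measurable_fun setT g -> (forall x, (0 <= g x)%E) ->
  (\int[fmu]_x g x = \int[mu]_x (g x * (f x)%:E))%E.
Proof.
move=> mg g0.
have mEf : measurable_fun setT (EFin \o f) by exact/measurable_EFinP.
pose h := nnsfun_approx measurableT mg.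
have mh n : measurable_fun setT (EFin \o h n) by exact/measurable_EFinP.
have cvh x : EFin (h n x) @[n --> \oo] --> g x.
  by apply: cvg_nnsfun_approx.
transitivity (limn (fun n => \int[fmu]_x (h n x)%:E)%E).
  rewrite -monotone_convergence//.
  - by apply: eq_integral => x _; apply/esym/cvg_lim.
  - by move=> n x _; rewrite lee_fin.
  - by move=> x _ m n mn; rewrite lee_fin; exact/lefP/nd_nnsfun_approx.
transitivity (limn (fun n => \int[mu]_x ((h n x)%:E * (f x)%:E))%E); last first.
  rewrite -monotone_convergence//.
  - apply: eq_integral => x _; apply/cvg_lim => //.
    exact: cvgeZr.
  - by move=> n; apply: emeasurable_funM; [exact: mh|exact: mEf].
  - by move=> n x _; rewrite mule_ge0 ?lee_fin.
  - move=> x _ m n mn; apply: lee_wpmul2r; first by rewrite lee_fin.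
    by rewrite lee_fin; exact/lefP/nd_nnsfun_approx.
congr (limn _); apply/funext => n.
under [LHS]eq_integral do rewrite fimfunE -fsumEFin//.
have indich r :
    measurable_fun [set: T] (fun x => (r * \1_(h n @^-1` [set r]) x)%:E).
  by apply/measurable_EFinP; exact: measurable_funM.
rewrite ge0_integral_fsum//; last by move=> r x _; exact: nnfun_muleindic_ge0.
under [RHS]eq_integral => x _.
  rewrite fimfunE -fsumEFin// ge0_mule_fsuml; last first.
    by move=> r; exact: nnfun_muleindic_ge0.
  over.
rewrite ge0_integral_fsum//; last 2 first.
- by move=> r; exact: emeasurable_funM.
- by move=> r x _; rewrite mule_ge0 ?lee_fin//; exact: nnfun_muleindic_ge0.
apply: eq_fsbigr => r rhn.
have r0 : 0 <= r by move: rhn; rewrite inE => -[t _ <-].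
under eq_integral do rewrite EFinM.
under [RHS]eq_integral do rewrite EFinM -muleA.
rewrite ge0_integralZl//; last exact/measurable_EFinP.
rewrite integral_indic// setIT ge0_integralZl//.
- congr (_ * _)%E; rewrite /= /density [LHS]integral_mkcond.
  by apply: eq_integral => x _; rewrite epatch_indic muleC.
- by apply: emeasurable_funM => //; exact/measurable_EFinP.
- by move=> x _; rewrite mule_ge0 ?lee_fin.
Qed.

End density.

(** * The correlation of the discretised vector *)

Section step_functions.
Context (R : realType).

Lemma measurable_le_cst d (T : measurableType d) (X : T -> R) (x : R) :
  measurable_fun setT X -> measurable [set w | X w <= x].
Proof.
move=> mX; rewrite (_ : [set w | _] = setT `&` X @^-1` `]-oo, x]%classic).
  exact: mX.
by apply/seteqP; split => w /=; rewrite in_itv/=; tauto.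
Qed.

(** Built from indicators of lower rays, so that expectations can be read off a joint distribution
    function. *)
Definition step (l : seq (R * R)) (u : R) : R :=
  \sum_(a <- l) a.1 * (u <= a.2)%R%:R.

(** The product of the indicators of [U <= a.2] and [V <= b.2] is the indicator of the joint event,
    whose probability is a value of [F]; the rest is bilinearity. *)
Lemma expectation_step_mul d (T : measurableType d) (P : probability T R)
    (U V : T -> R) (F : R -> R -> R) (l m : seq (R * R)) :
  measurable_fun setT U -> measurable_fun setT V ->
  (forall u v, P [set w | U w <= u /\ V w <= v] = (F u v)%:E) ->
  'E_P[(step l \o U) * (step m \o V)]%E =
  (\sum_(a <- l) \sum_(b <- m) a.1 * b.1 * F a.2 b.2)%:E.
Proof.
move=> mU mV PUV; rewrite unlock.
have mA u v : measurable [set w | U w <= u /\ V w <= v].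
  by apply: measurableI; exact: measurable_le_cst.
have intA c u v : P.-integrable setT
    (fun w => (c * \1_[set w | U w <= u /\ V w <= v] w)%:E).
  under eq_fun do rewrite EFinM.
  by apply: integrableZl => //; exact: integrable_indic.
transitivity (\int[P]_w (\sum_(a <- l) \sum_(b <- m)
    (a.1 * b.1 * \1_[set w | U w <= a.2 /\ V w <= b.2] w)%:E))%E.
  apply: eq_integral => w _; rewrite fctE /= /step.
  under [RHS]eq_bigr do rewrite sumEFin.
  rewrite sumEFin mulr_suml; congr EFin; apply: eq_bigr => a _.
  rewrite mulr_sumr; apply: eq_bigr => b _.
  rewrite mulrACA indicE -natrM mulnb; congr (_ * (nat_of_bool _)%:R).
  by apply/andP/idP; rewrite inE.
rewrite integral_sum//; last by move=> a; apply: integrable_sum => //.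
rewrite -sumEFin; apply: eq_bigr => a _.
rewrite integral_sum// -sumEFin; apply: eq_bigr => b _.
under eq_integral do rewrite EFinM.
rewrite integralZl//; last first.
  by have := intA 1 a.2 b.2; under eq_fun do rewrite mul1r.
rewrite integral_indic// setIT.
by rewrite [RHS]EFinM; congr (_ * _)%E; exact: PUV.
Qed.

End step_functions.

(** * The quantile function of the three-point law *)

Section quantile.
Context (R : realType).

Lemma GdistE (p x : R) : Gdist p x =
  p * (-1 <= x)%R%:R + (1 - 2 * p) * (0 <= x)%R%:R + p * (1 <= x)%R%:R.
Proof.
have indic a : \1_`[a, +oo[%classic x = (a <= x)%R%:R :> R.
  rewrite indicE; congr (nat_of_bool _)%:R.
  by apply/idP/idP; rewrite inE/= in_itv/= andbT.
by rewrite /Gdist !indic.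
Qed.

(* Outside (0, 1] the set under the infimum is either empty or unbounded and
   [inf] returns 0. *)
Lemma quantile_Gdist (p : R) : 0 < p <= 2^-1 ->
  quantile (Gdist p) =
  step [:: (1, 1); (- 1, 1 - p); (- 1, p); (1, 0)].
Proof.
move=> /andP[p0 p2]; apply/funext => u; rewrite /step !big_cons big_nil/=.
have infE a : [set x | u <= Gdist p x] = `[a, +oo[%classic ->
    quantile (Gdist p) u = a.
  by rewrite /quantile => ->; rewrite inf_itv.
(* Five ranges of [u] survive, separated by 0, [p], [1 - p] and 1; the other combinations contradict
   [0 < p <= 2^-1]. On (0, 1] the list amounts to 1 minus the indicators of [u <= 1 - p] and
   [u <= p]; the entry [(1, 0)] restores the default value 0 for [u <= 0]. *)
case: (lerP u 0) => u0; case: (lerP u p) => up;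
  case: (lerP u (1 - p)) => u1p; case: (lerP u 1) => u1; try (exfalso; lra).
- rewrite /quantile (_ : [set x | _] = setT).
    rewrite inf_out; first by rewrite /=; lra.
    by move=> [_ [b]] /(_ (b - 1) I); rewrite lerBrDr gerDl ler10.
  apply/seteqP; split => x //= _; rewrite GdistE (le_trans u0)//.
  by rewrite !addr_ge0// mulr_ge0//; lra.
- rewrite (infE (-1)); first by rewrite /=; lra.
  apply/seteqP; split => x /=; rewrite in_itv/= andbT GdistE;
    case: (lerP (-1) x) => x1; case: (lerP 0 x) => x2;
    case: (lerP 1 x) => x3 //=; lra.
- rewrite (infE 0); first by rewrite /=; lra.
  apply/seteqP; split => x /=; rewrite in_itv/= andbT GdistE;
    case: (lerP (-1) x) => x1; case: (lerP 0 x) => x2;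
    case: (lerP 1 x) => x3 //=; lra.
- rewrite (infE 1); first by rewrite /=; lra.
  apply/seteqP; split => x /=; rewrite in_itv/= andbT GdistE;
    case: (lerP (-1) x) => x1; case: (lerP 0 x) => x2;
    case: (lerP 1 x) => x3 //=; lra.
rewrite /quantile (_ : [set x | _] = set0); first by rewrite inf0 /=; lra.
apply/seteqP; split => x //=; rewrite GdistE;
  case: (lerP (-1) x) => x1; case: (lerP 0 x) => x2;
  case: (lerP 1 x) => x3 //=; lra.
Qed.

End quantile.

(** Split A into its parts inside and outside B: the outer part is disjoint from B, so together they
    have probability at most 1. *)
Lemma probability_setI_ge d (T : measurableType d) (R : realType)
    (P : probability T R) (A B : set T) : measurable A -> measurable B ->
  (P A + P B <= P (A `&` B) + 1)%E.
Proof.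
move=> mA mB; rewrite [in leLHS](measureDI P mA mB) addeAC addeC leeD2l//.
rewrite -measureU//; [|exact: measurableD|by rewrite setDKI].
by rewrite probability_le1//; apply: measurableU => //; exact: measurableD.
Qed.

Lemma probability_setI1 d (T : measurableType d) (R : realType)
    (P : probability T R) (A B : set T) : measurable A -> measurable B ->
  P B = 1%E -> P A = P (A `&` B).
Proof.
move=> mA mB PB; apply/eqP; rewrite eq_le; apply/andP; split; last first.
  exact: measureIl.
by have := probability_setI_ge P mA mB; rewrite PB leeD2rE.
Qed.

Lemma measurable_le_fun d (T : measurableType d) (R : realType) (X Y : T -> R) :
  measurable_fun setT X -> measurable_fun setT Y ->
  measurable [set w | X w <= Y w].
Proof.
move=> mX mY; have /(_ measurableT [set true]) := measurable_fun_ler mX mY.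
by rewrite setTI; exact.
Qed.

(** * Bounds, measurability and margins of copulas *)

Section copula_facts.
Context (R : realType) (C : copula R).

(** The Frechet-Hoeffding bounds: the upper one is monotonicity of P, the lower one is
    [probability_setI_ge]. *)
Lemma copula_bounds u v : 0 <= u <= 1 -> 0 <= v <= 1 ->
  Num.max 0 (u + v - 1) <= C u v <= Num.min u v.
Proof.
have [P [CE P1 P2]] := copulaP C => u01 v01.
have m1 : measurable [set x : R * R | x.1 <= u] by exact: measurable_le_cst.
have m2 : measurable [set x : R * R | x.2 <= v] by exact: measurable_le_cst.
have CI : (C u v)%:E = P ([set x | x.1 <= u] `&` [set x | x.2 <= v]).
  by rewrite CE.
have mI : measurable ([set x : R * R | x.1 <= u] `&` [set x | x.2 <= v]).
  exact: measurableI.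
rewrite ge_max le_min -andbA; apply/and4P; split.
- by rewrite -lee_fin CI.
- rewrite lerBlDr -lee_fin !EFinD -P1// -P2// CI.
  exact: probability_setI_ge.
- by rewrite -lee_fin CI -P1// measureIl.
- by rewrite -lee_fin CI -P2// measureIr.
Qed.

Lemma copula_u1 u : 0 <= u <= 1 -> C u 1 = u.
Proof.
move=> u01; have := copula_bounds u01 (_ : 0 <= 1 <= 1).
by rewrite ler01 lexx addrK ge_max le_min => /(_ isT) ?; lra.
Qed.

Lemma copula_1v v : 0 <= v <= 1 -> C 1 v = v.
Proof.
move=> v01; have := @copula_bounds 1 v _ v01.
by rewrite ler01 lexx addrAC subrr add0r ge_max le_min => /(_ isT) ?; lra.
Qed.

(** C(x) is the P-measure of the section at x of the set of pairs (x, y) with y below x in both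
    coordinates, and measures of sections depend measurably on the base point. *)
Lemma measurable_copula : measurable_fun setT (fun x : R * R => C x.1 x.2).
Proof.
have [P [CE _ _]] := copulaP C.
pose A := [set z : (R * R) * (R * R) | z.2.1 <= z.1.1 /\ z.2.2 <= z.1.2].
have mA : measurable A.
  apply: measurableI; apply: measurable_le_fun; apply: measurableT_comp => //.
have := measurable_fun_xsection P mA.
rewrite (_ : _ \o _ = EFin \o (fun x : R * R => C x.1 x.2)).
  by move/measurable_EFinP.
apply/funext => x /=; rewrite CE; congr (P _).
by apply/seteqP; split=> y; rewrite /xsection /= inE.
Qed.

(** Since C(1, 1) = 1, both variables are almost surely at most 1; intersecting with such an event
    turns a marginal probability into C(u, 1) or C(1, u). *)
Lemma copula_marginals d (T : measurableType d) (P : probability T R)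
    (U V : T -> R) u : has_copula P U V C -> 0 <= u <= 1 ->
  P [set w | U w <= u] = u%:E /\ P [set w | V w <= u] = u%:E.
Proof.
move=> [mU mV PUV] u01; have h1 : 0 <= (1 : R) <= 1 by rewrite ler01 lexx.
have mUu a : measurable [set w | U w <= a] by exact: measurable_le_cst.
have mVu a : measurable [set w | V w <= a] by exact: measurable_le_cst.
have P1 : P ([set w | U w <= 1] `&` [set w | V w <= 1]) = 1%E.
  by rewrite [LHS]PUV copula_u1.
split.
- rewrite (probability_setI1 (B := [set w | V w <= 1]))//.
    by rewrite [LHS]PUV copula_u1.
  apply/eqP; rewrite eq_le probability_le1//= -P1; exact: measureIr.
- rewrite (probability_setI1 (B := [set w | U w <= 1]))// 1?setIC.
    by rewrite [LHS]PUV copula_1v.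
  apply/eqP; rewrite eq_le probability_le1//= -P1; exact: measureIl.
Qed.

End copula_facts.

(** * Covariance and correlation of the three-point variables *)

Lemma covariance_centered d (T : measurableType d) (R : realType)
    (P : probability T R) (X Y : T -> R) :
  'E_P[X]%E = 0%E -> 'E_P[Y]%E = 0%E -> covariance P X Y = 'E_P[X * Y]%E.
Proof.
move=> X0 Y0; rewrite covariance.unlock X0 Y0/=; congr expectation.
by apply/funext => w; rewrite !fctE /= !subr0.
Qed.

Definition corner_sum (R : realType) (C : R -> R -> R) (p : R) : R :=
  C p p + C (1 - p) (1 - p) + C p (1 - p) + C (1 - p) p.

Definition corner_corr (R : realType) (C : R -> R -> R) (p : R) : R :=
  (corner_sum C p - 1) / (2 * p).

Section pearson.
Context d (T : measurableType d) (R : realType) (P : probability T R).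
Variable p : R.
Hypothesis p02 : 0 < p <= 2^-1.

Let q := quantile (Gdist p).

Let p01 : [/\ 0 <= (0 : R) <= 1, 0 <= (1 : R) <= 1, 0 <= p <= 1 &
  0 <= 1 - p <= 1].
Proof. by move: p02 => /andP[? ?]; split; apply/andP; split; lra. Qed.

Lemma expectation_quantile (U : T -> R) : measurable_fun setT U ->
  (forall u, 0 <= u <= 1 -> P [set w | U w <= u] = u%:E) ->
  'E_P[q \o U]%E = 0%E.
Proof.
have [h0 h1 hp h1p] := p01.
move=> mU PU; rewrite /q quantile_Gdist//.
have FE u v : P [set w | U w <= u /\ (cst 0 : T -> R) w <= v] =
    (fine (P [set w | U w <= u /\ (cst 0 : T -> R) w <= v]))%:E.
  rewrite fineK// fin_num_measure//.
  by apply: measurableI; apply: measurable_le_cst.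
(* A single expectation is obtained as that of a product: the second variable is constantly 0, where
   the step function [[:: (1, 0)]] takes the value 1. *)
have := @expectation_step_mul _ _ _ P U (cst 0) _
  [:: (1, 1); (- 1, 1 - p); (- 1, p); (1, 0)] [:: (1, 0)]
  mU (measurable_cst _) FE.
rewrite (_ : _ * (step [:: (1, 0)] \o cst 0) =
    step [:: (1, 1); (-1, 1 - p); (-1, p); (1, 0)] \o U); last first.
  by apply/funext => w; rewrite !fctE /= /step big_seq1 lexx !mulr1.
move=> ->; rewrite !big_cons !big_nil/=.
have E u : 0 <= u <= 1 -> fine (P [set w | U w <= u /\ 0 <= 0 :> R]) = u.
  move=> u01; rewrite -[RHS]/(fine u%:E) -PU//; congr (fine (P _)).
  by apply/seteqP; split => x //= [].
by rewrite !E//; congr EFin; lra.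
Qed.

(** Stated for a bare joint distribution function [F] so that it also applies to a pair (W, W) and
    yields the variance. In the expansion the terms with a threshold 0 vanish, those with a
    threshold 1 sum to -1, and the remaining four form the corner sum. *)
Lemma covariance_quantile (U V : T -> R) (F : R -> R -> R) :
  measurable_fun setT U -> measurable_fun setT V ->
  (forall u, 0 <= u <= 1 -> P [set w | U w <= u] = u%:E) ->
  (forall u, 0 <= u <= 1 -> P [set w | V w <= u] = u%:E) ->
  (forall u v, P [set w | U w <= u /\ V w <= v] = (F u v)%:E) ->
  covariance P (q \o U) (q \o V) = (corner_sum F p - 1)%:E.
Proof.
have [h0 h1 hp h1p] := p01.
move=> mU mV PU PV PUV.
rewrite covariance_centered ?expectation_quantile// /q quantile_Gdist//.
rewrite (expectation_step_mul _ _ mU mV PUV) /corner_sum.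
have mUu a : measurable [set w | U w <= a] by exact: measurable_le_cst.
have mVu a : measurable [set w | V w <= a] by exact: measurable_le_cst.
have Fu0 u : F u 0 = 0.
  apply/eqP; rewrite -eqe -PUV eq_le measure_ge0 andbT -(PV 0)//.
  exact: (measureIr P (mUu u) (mVu 0)).
have F0v v : F 0 v = 0.
  apply/eqP; rewrite -eqe -PUV eq_le measure_ge0 andbT -(PU 0)//.
  exact: (measureIl P (mUu 0) (mVu v)).
have Fu1 u : 0 <= u <= 1 -> F u 1 = u.
  move=> u01; apply/EFin_inj; rewrite -PUV -PU//; symmetry.
  exact: (probability_setI1 _ _ (PV 1 _)).
have F1v v : 0 <= v <= 1 -> F 1 v = v.
  move=> v01; apply/EFin_inj; rewrite -PUV -PV//; symmetry.
  rewrite [X in _ = P X](_ : _ = [set w | V w <= v] `&` [set w | U w <= 1]).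
    exact: (probability_setI1 _ _ (PU 1 _)).
  by apply/seteqP; split => x [].
rewrite !big_cons !big_nil/= !Fu0 !F0v !Fu1// !F1v//; congr EFin; lra.
Qed.

Lemma pearson_quantile (U V : T -> R) (C : copula R) : has_copula P U V C ->
  pearson P (q \o U) (q \o V) = corner_corr C p.
Proof.
move=> UV; have [mU mV PUV] := UV.
have PU u := (copula_marginals UV : _ -> _ /\ _).
have {}PU u (u01 : 0 <= u <= 1) := (copula_marginals UV u01).1.
have {}PV u (u01 : 0 <= u <= 1) := (copula_marginals UV u01).2.
have var (W : T -> R) : measurable_fun setT W ->
    (forall u, 0 <= u <= 1 -> P [set w | W w <= u] = u%:E) ->
    ('V_P[q \o W] = (2 * p)%:E)%E.
  move=> mW PW; rewrite /variance.
  (* The joint distribution function of (W, W); its corner sum is 1 + 2p, whence the variance 2p. *)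
  pose F u v := fine (P [set w | W w <= Num.min u v]).
  rewrite (covariance_quantile (F := F))//.
    have [h0 h1 hp h1p] := p01; move: p02 => /andP[? ?].
    rewrite /corner_sum /F !minxx (min_l (_ : p <= 1 - p)); last by lra.
    rewrite (min_r (_ : p <= 1 - p)) ?PW//=; last by lra.
    by congr EFin; lra.
  move=> u v.
  rewrite /F fineK ?fin_num_measure//; last exact: measurable_le_cst.
  by congr (P _); apply/seteqP; split => x /=; rewrite le_min => /andP.
rewrite /pearson (covariance_quantile mU mV PU PV PUV) !var//=.
rewrite -expr2 sqr_sqrtr// mulr_ge0//; by move: p02 => /andP[/ltW].
Qed.

End pearson.

(** * Existence *)

Section probability_of_measure.
Context d (T : measurableType d) (R : realType).
Variables (m : {measure set T -> \bar R}) (m1 : m setT = 1%E).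

Definition probability_of_measure of m setT = 1%E : set T -> \bar R := m.

HB.instance Definition _ := Measure.on (probability_of_measure m1).

HB.instance Definition _ :=
  @Measure_isProbability.Build _ _ _ (probability_of_measure m1) m1.

End probability_of_measure.

(** * Reflection-invariant measures on the square *)

Section diagonal_measures.
Context (R : realType).
Implicit Types x : R * R.

Definition edge_dist x : R := Num.min x.1 (1 - x.1).

Lemma measurable_edge_dist : measurable_fun setT edge_dist.
Proof. by apply: measurable_minr => //; apply: measurable_funB. Qed.

Lemma measurable_unit_square : measurable (@unit_square R).
Proof.
rewrite (_ : unit_square = `]0, 1[%classic `*` `]0, 1[%classic).
  exact: measurableX.
by apply/seteqP; split => x /=; rewrite !in_itv.
Qed.

Lemma measurable_diagonals : measurable (@diagonals R).
Proof.
have mE (X Y : R * R -> R) : measurable_fun setT X -> measurable_fun setT Y ->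
    measurable [set z | X z = Y z].
  move=> mX mY.
  rewrite (_ : [set z | _] =
      [set z | X z <= Y z] `&` [set z | Y z <= X z]).
    by apply: measurableI; apply: measurable_le_fun.
  apply/seteqP; split => z /=; first by move=> ->; rewrite lexx.
  by move=> [? ?]; apply/eqP; rewrite eq_le; apply/andP.
by apply: measurableU; apply: mE => //; apply: measurable_funD.
Qed.

Lemma edge_dist_itv x : unit_square x -> 0 < edge_dist x <= 2^-1.
Proof.
move=> [/andP[? ?] _]; rewrite /edge_dist lt_min ge_min.
by case: (lerP x.1 2^-1) => h /=; apply/andP;
  split; try (apply/andP; split); lra.
Qed.

Lemma edge_dist_sigma1 x : edge_dist (sym_sigma1 x) = edge_dist x.
Proof. by rewrite /edge_dist /= subKr minC. Qed.

Lemma measurable_sigma1 : measurable_fun setT (@sym_sigma1 R).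
Proof.
by apply/measurable_fun_pairP; split; rewrite /comp/=;
  [exact: measurable_funB|exact: measurable_snd].
Qed.

Lemma measurable_sigma2 : measurable_fun setT (@sym_sigma2 R).
Proof.
by apply/measurable_fun_pairP; split; rewrite /comp/=;
  [exact: measurable_fst|exact: measurable_funB].
Qed.

Variable mu : {measure set (R * R)%type -> \bar R}.

Section reflections.
Hypothesis mu_D4 : forall xi : R * R -> R * R, D4 xi -> forall A : set (R * R),
  measurable A -> A `<=` unit_square -> mu (xi @` A) = mu A.

(** Preimages under an involution are images, so by invariance the image measure of [mu] under [xi]
    agrees with [mu] on measurable subsets of the square. This settles nonnegative integrands; the
    general case splits [g] into its positive and negative parts. *)
Lemma integral_involution (xi : R * R -> R * R) (g : R * R -> \bar R) :
  D4 xi -> measurable_fun setT xi -> involutive xi ->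
  (forall x, unit_square x -> unit_square (xi x)) -> measurable_fun setT g ->
  (\int[mu]_(x in unit_square) g (xi x) = \int[mu]_(x in unit_square) g x)%E.
Proof.
move=> Dxi mxi xiK xiU.
have preE (A : set (R * R)) : xi @^-1` A = xi @` A.
  apply/seteqP; split => x /=; first by move=> Ax; exists (xi x).
  by move=> [y Ay <-]; rewrite xiK.
have ge0 (h : R * R -> \bar R) :
    measurable_fun setT h -> (forall x, 0 <= h x)%E ->
    (\int[mu]_(x in unit_square) h (xi x) = \int[mu]_(x in unit_square) h x)%E.
  move=> mh h0.
  have -> : (\int[mu]_(x in unit_square) h x =
      \int[pushforward mu xi]_(x in unit_square) h x)%E.
    apply: eq_measure_integral => A mA AU /=.
    by rewrite /pushforward preE mu_D4.
  rewrite [RHS]ge0_integral_pushforward//; last 2 first.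
  - exact: measurable_unit_square.
  - exact: measurable_funTS.
  congr integral; apply/seteqP; split => x /=; first exact: xiU.
  by move=> /xiU; rewrite xiK.
move=> mg; rewrite (integralE mu _ g) (integralE mu _ (fun x => g (xi x))).
have gp := ge0 _ (measurable_funepos mg) (funepos_ge0 g).
have gn := ge0 _ (measurable_funeneg mg) (funeneg_ge0 g).
by rewrite -gp -gn; congr (_ - _)%E; apply: eq_integral => x _;
  rewrite ?funeposE ?funenegE.
Qed.

Lemma integral_sigma1 (g : R * R -> \bar R) : measurable_fun setT g ->
  (\int[mu]_(x in unit_square) g (sym_sigma1 x) =
   \int[mu]_(x in unit_square) g x)%E.
Proof.
apply: integral_involution.
- by rewrite /D4/=; tauto.
- exact: measurable_sigma1.
- by move=> [a b]; rewrite /sym_sigma1/= subKr.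
- by move=> x [/andP[? ?] ?]; split=> //=; apply/andP; split; lra.
Qed.

Lemma integral_sigma2 (g : R * R -> \bar R) : measurable_fun setT g ->
  (\int[mu]_(x in unit_square) g (sym_sigma2 x) =
   \int[mu]_(x in unit_square) g x)%E.
Proof.
apply: integral_involution.
- by rewrite /D4/=; tauto.
- exact: measurable_sigma2.
- by move=> [a b]; rewrite /sym_sigma2/= subKr.
- by move=> x [? /andP[? ?]]; split=> //=; apply/andP; split; lra.
Qed.

End reflections.

Lemma eq_integral_diagonals (f g : R * R -> \bar R) :
  mu (unit_square `\` diagonals) = 0%E ->
  measurable_fun setT f -> measurable_fun setT g ->
  (forall x, unit_square x -> diagonals x -> f x = g x) ->
  (\int[mu]_(x in unit_square) f x = \int[mu]_(x in unit_square) g x)%E.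
Proof.
move=> mud mf mg fg; apply: ae_eq_integral.
- exact: measurable_unit_square.
- exact: measurable_funTS.
- exact: measurable_funTS.
exists (unit_square `\` diagonals); split => //.
  by apply: measurableD;
    [exact: measurable_unit_square|exact: measurable_diagonals].
move=> x /= /not_implyP[Ux fgx]; split=> // dx; apply: fgx; exact: fg.
Qed.

End diagonal_measures.

(** * Integrals of C - Pi expressed through the edge distance *)

Section gini_integral.
Context (R : realType).
Implicit Types x : R * R.

Definition copula_excess (C : R -> R -> R) x : R := C x.1 x.2 - copPi x.1 x.2.

Lemma measurable_copula_excess (C : copula R) :
  measurable_fun setT (copula_excess C).
Proof.
by apply: measurable_funB; [exact: measurable_copula|exact: measurable_funM].
Qed.

Lemma measurable_copM_excess : measurable_fun setT (@copula_excess copM).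
Proof.
by apply: measurable_funB; [exact: measurable_minr|exact: measurable_funM].
Qed.

Lemma copM_excess_ge0 x : unit_square x -> 0 <= copula_excess copM x.
Proof.
move=> [/andP[? ?] /andP[? ?]]; rewrite subr_ge0 /copM /copPi le_min.
by apply/andP; split; nra.
Qed.

(** By [copula_bounds], C - Pi is at most u(1 - v) and v(1 - u), and Pi - C is at most uv and (1 -
    u)(1 - v). This supplies the domination for integrability. *)
Lemma normr_copula_excess_le (C : copula R) x : unit_square x ->
  `|copula_excess C x| <= edge_dist x.
Proof.
move=> [/andP[a0 a1] /andP[b0 b1]].
have := @copula_bounds _ C x.1 x.2; rewrite (ltW a0) (ltW a1) (ltW b0) (ltW b1).
rewrite ge_max le_min => /(_ isT isT) /andP[/andP[c1 c2] /andP[c3 c4]].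
by rewrite ler_norml /edge_dist lerNl !le_min /copula_excess /copPi;
  apply/andP; split; apply/andP; split; nra.
Qed.

(* On the diagonals, the images of [x] under the reflections are the four
   points of {w, 1 - w} x {w, 1 - w} where [w] is the distance to the edges. *)
Lemma corner_sumE (C : copula R) x : unit_square x -> diagonals x ->
  corner_sum C (edge_dist x) - 1 =
  copula_excess C x + copula_excess C (sym_sigma1 x) +
  (copula_excess C (sym_sigma2 x) +
   copula_excess C (sym_sigma1 (sym_sigma2 x))).
Proof.
case: x => u v [/andP[/= a0 a1] /andP[b0 b1]] uv.
rewrite /corner_sum /copula_excess /edge_dist /copPi /=.
have {}uv : u = v \/ v = 1 - u by case: uv => /= ?; [left|right; lra].
case: uv => ->.
  by case: (lerP v (1 - v)) => _; rewrite ?subKr; ring.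
by case: (lerP u (1 - u)) => _; rewrite ?subKr; ring.
Qed.

(** M - Pi is v(1 - v) at (v, v) and min(v, 1 - v) - v(1 - v) at (v, 1 - v). The reflection
    exchanges the diagonals, and the products cancel in the sum. *)
Lemma copM_excess_edge_dist x : unit_square x -> diagonals x ->
  edge_dist x = copula_excess copM x + copula_excess copM (sym_sigma2 x).
Proof.
case: x => u v [/andP[/= a0 a1] /andP[b0 b1]] uv.
rewrite /copula_excess /edge_dist /copPi /copM /=.
have {}uv : u = v \/ v = 1 - u by case: uv => /= ?; [left|right; lra].
case: uv => ->; rewrite ?subKr minxx.
  by case: (lerP v (1 - v)) => _; ring.
by case: (lerP u (1 - u)) => _; ring.
Qed.

(** The bounds of [copula_bounds] at the four corners sum to 1 + 2p above and 1 - 2p below;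
    equivalently, for p > 0, [corner_corr] lies in [-1, 1]. *)
Lemma normr_corner_sum_le (C : copula R) (p : R) : 0 <= p <= 2^-1 ->
  `|corner_sum C p - 1| <= 2 * p.
Proof.
move=> /andP[p0 p2]; have hp : 0 <= p <= 1 by apply/andP; split; lra.
have hp' : 0 <= 1 - p <= 1 by apply/andP; split; lra.
have := copula_bounds C hp hp; have := copula_bounds C hp' hp'.
have := copula_bounds C hp hp'; have := copula_bounds C hp' hp.
rewrite !ge_max !le_min => /andP[/andP[? ?] /andP[? ?]].
move=> /andP[/andP[? ?] /andP[? ?]] /andP[/andP[? ?] /andP[? ?]].
move=> /andP[/andP[? ?] /andP[? ?]].
by rewrite /corner_sum ler_norml; apply/andP; split; lra.
Qed.

Lemma measurable_corner_sum (C : copula R) : measurable_fun setT (corner_sum C).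
Proof.
have mC (f g : R -> R) : measurable_fun setT f -> measurable_fun setT g ->
    measurable_fun setT (fun p => C (f p) (g p)).
  move=> mf mg; rewrite (_ : (fun _ => _) =
      (fun z : R * R => C z.1 z.2) \o (fun p => (f p, g p)))//.
  apply: measurableT_comp; first exact: measurable_copula.
  exact: measurable_fun_pair.
have mB : measurable_fun setT (fun p : R => 1 - p) by exact: measurable_funB.
by rewrite /corner_sum; repeat apply: measurable_funD; apply: mC.
Qed.

Lemma measurable_corner_corr (C : copula R) :
  measurable_fun half_itv (corner_corr C).
Proof.
(* The reciprocal is replaced by a real power, which is measurable on the whole line and agrees with
   it on [half_itv]. *)
have mp : measurable_fun setT (fun p : R => (2 * p) `^ (- 1)).
  rewrite (_ : (fun _ => _) = (@powR R ^~ (- 1)) \o (fun p => 2 * p))//.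
  by apply: measurableT_comp; [exact: measurable_powR|exact: measurable_funM].
apply: (eq_measurable_fun (fun p => (corner_sum C p - 1) * (2 * p) `^ (- 1))).
  move=> p; rewrite inE /half_itv /= in_itv/= => /andP[p0 _].
  by rewrite powR_inv1// mulr_ge0// ltW.
apply: measurable_funTS; apply: measurable_funM => //.
by apply: measurable_funB => //; exact: measurable_corner_sum.
Qed.

Variable mu : {measure set (R * R)%type -> \bar R}.
Hypothesis mu_D4 : forall xi : R * R -> R * R, D4 xi -> forall A : set (R * R),
  measurable A -> A `<=` unit_square -> mu (xi @` A) = mu A.
Hypothesis mu_diagonals : mu (unit_square `\` diagonals) = 0%E.
Hypothesis mu_lty :
  (\int[mu]_(x in unit_square) (copula_excess copM x)%:E < +oo)%E.

Let mU := @measurable_unit_square R.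

Lemma integral_edge_dist :
  (\int[mu]_(x in unit_square) (edge_dist x)%:E =
   \int[mu]_(x in unit_square) (copula_excess copM x)%:E +
   \int[mu]_(x in unit_square) (copula_excess copM x)%:E)%E.
Proof.
have mM : measurable_fun setT (EFin \o copula_excess copM).
  by apply/measurable_EFinP; exact: measurable_copM_excess.
have mM2 : measurable_fun setT (EFin \o (copula_excess copM \o sym_sigma2)).
  apply/measurable_EFinP.
  apply: measurableT_comp; last exact: measurable_sigma2.
  exact: measurable_copM_excess.
(* Both copies of the integral are reflected and the first is reflected back, which leaves one plain
   and one reflected integrand, as in [copM_excess_edge_dist]. *)
rewrite -[in RHS](integral_sigma2 mu_D4 mM).
rewrite [X in _ = (X + _)%E](integral_sigma2 mu_D4 mM).
rewrite -ge0_integralD//=.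
- apply: eq_integral_diagonals => //.
  + by apply/measurable_EFinP; exact: measurable_edge_dist.
  + exact: emeasurable_funD.
  + by move=> x Ux dx; rewrite -EFinD -copM_excess_edge_dist.
- by move=> x /copM_excess_ge0.
- exact: measurable_funTS.
- move=> x [? /andP[? ?]]; rewrite lee_fin copM_excess_ge0//.
  by split=> //=; apply/andP; split; lra.
- exact: measurable_funTS.
Qed.

Lemma integrable_edge_dist : mu.-integrable unit_square (EFin \o @edge_dist R).
Proof.
apply/integrableP; split.
  by apply/measurable_EFinP/measurable_funTS; exact: measurable_edge_dist.
rewrite (eq_integral (fun x => (edge_dist x)%:E)).
  by rewrite integral_edge_dist lte_add_pinfty.
move=> x; rewrite inE => /edge_dist_itv /andP[/ltW w0 _].
by rewrite /= ger0_norm.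
Qed.

(** The mass of [mu] may be infinite, so boundedness does not give integrability; a multiple of the
    integrable [edge_dist] serves as the dominating function. *)
Lemma integrable_le_edge_dist (k : R) (f : R * R -> R) :
  measurable_fun setT f ->
  (forall x, unit_square x -> `|f x| <= k * edge_dist x) ->
  mu.-integrable unit_square (EFin \o f).
Proof.
move=> mf fw.
apply: le_integrable (integrableZl mU k integrable_edge_dist) => //.
  by apply/measurable_EFinP/measurable_funTS.
move=> x Ux /=; rewrite lee_fin (le_trans (fw _ Ux))//.
exact: ler_norm.
Qed.

Lemma unit_square_sigma1 x : unit_square x -> unit_square (sym_sigma1 x).
Proof. by move=> [/andP[? ?] ?]; split=> //=; apply/andP; split; lra. Qed.

Lemma unit_square_sigma2 x : unit_square x -> unit_square (sym_sigma2 x).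
Proof. by move=> [? /andP[? ?]]; split=> //=; apply/andP; split; lra. Qed.

Lemma measurable_corner_sum_edge_dist (C : copula R) :
  measurable_fun setT (fun x => corner_sum C (edge_dist x) - 1).
Proof.
apply: measurable_funB => //.
apply: measurableT_comp; last exact: measurable_edge_dist.
exact: measurable_corner_sum.
Qed.

(** Integrate [corner_sumE]: each of its four summands is integrable, and by invariance each has the
    same integral. *)
Lemma Rintegral_corner_sum (C : copula R) :
  \int[mu]_(x in unit_square) (corner_sum C (edge_dist x) - 1) =
  4 * \int[mu]_(x in unit_square) copula_excess C x.
Proof.
pose h := copula_excess C.
have mh : measurable_fun setT h := measurable_copula_excess C.
have m1 := @measurable_sigma1 R; have m2 := @measurable_sigma2 R.
have mh1 : measurable_fun setT (h \o sym_sigma1) by exact: measurableT_comp.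
have mh2 : measurable_fun setT (h \o sym_sigma2) by exact: measurableT_comp.
have mh12 : measurable_fun setT (h \o sym_sigma1 \o sym_sigma2).
  exact: measurableT_comp.
have U1 := unit_square_sigma1; have U2 := unit_square_sigma2.
have h_le := normr_copula_excess_le C.
have ih : mu.-integrable unit_square (EFin \o h).
  by apply: (@integrable_le_edge_dist 1) => // x /h_le; rewrite mul1r.
have ih1 : mu.-integrable unit_square (EFin \o (h \o sym_sigma1)).
  apply: (@integrable_le_edge_dist 1) => // x /U1 /h_le.
  by rewrite mul1r edge_dist_sigma1.
have ih2 : mu.-integrable unit_square (EFin \o (h \o sym_sigma2)).
  by apply: (@integrable_le_edge_dist 1) => // x /U2 /h_le; rewrite mul1r.
have ih12 :
    mu.-integrable unit_square (EFin \o (h \o sym_sigma1 \o sym_sigma2)).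
  apply: (@integrable_le_edge_dist 1) => // x /U2/U1 /h_le.
  by rewrite mul1r edge_dist_sigma1.
have E1 : \int[mu]_(x in unit_square) h (sym_sigma1 x) =
    \int[mu]_(x in unit_square) h x.
  congr fine; rewrite (integral_sigma1 mu_D4 (g := EFin \o h))//.
  exact/measurable_EFinP.
have E2 : \int[mu]_(x in unit_square) h (sym_sigma2 x) =
    \int[mu]_(x in unit_square) h x.
  congr fine; rewrite (integral_sigma2 mu_D4 (g := EFin \o h))//.
  exact/measurable_EFinP.
have E12 : \int[mu]_(x in unit_square) h (sym_sigma1 (sym_sigma2 x)) =
    \int[mu]_(x in unit_square) h x.
  rewrite -E1; congr fine.
  rewrite (integral_sigma2 mu_D4 (g := EFin \o (h \o sym_sigma1)))//.
  exact/measurable_EFinP.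
have mS := measurable_corner_sum_edge_dist C.
rewrite (_ : \int[mu]_(x in unit_square) (corner_sum C (edge_dist x) - 1) =
    \int[mu]_(x in unit_square) (h x + h (sym_sigma1 x) +
      (h (sym_sigma2 x) + h (sym_sigma1 (sym_sigma2 x))))); last first.
  congr fine; apply: eq_integral_diagonals => //.
  - exact/measurable_EFinP.
  - by apply/measurable_EFinP; do 2 apply: measurable_funD => //.
  - by move=> x Ux dx; rewrite corner_sumE.
rewrite RintegralD//; last 2 first.
- exact: (integrableD mU ih ih1).
- exact: (integrableD mU ih2 ih12).
rewrite (RintegralD mU ih ih1) (RintegralD mU ih2 ih12) /= E1 E2 E12 -/h; lra.
Qed.

End gini_integral.

(** * Construction of the representing measure *)

HB.instance Definition _ (R : realType) :=
  @isMeasurableFun.Build _ _ _ _ (@edge_dist R) (@measurable_edge_dist R).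

Lemma gamma_at_corner_corr (R : realType) (nu : probability R R)
    (C : copula R) d (T : measurableType d) (P : probability T R)
    (U V : T -> R) :
  has_copula P U V C ->
  gamma_at nu P U V = \int[nu]_(p in half_itv) corner_corr C p.
Proof.
move=> UV; apply: eq_Rintegral => p; rewrite inE /half_itv /= in_itv => p02.
exact: pearson_quantile.
Qed.

Lemma gini_gamma_exists (R : realType) (kappa : copula R -> R) :
  generalized_gini kappa ->
  exists nu : probability R R, gamma_represents nu kappa.
Proof.
move=> [_ [mu [[_ mu_D4 /andP[N0 Noo]] mu_diag kappaE]]].
have mU := @measurable_unit_square R.
have mw := @measurable_edge_dist R.
have mhalf : measurable (@half_itv R) by exact: measurable_itv.
pose N : R := \int[mu]_(x in unit_square) (copula_excess copM x).
have NE : N%:E = (\int[mu]_(x in unit_square) (copula_excess copM x)%:E)%E.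
  by rewrite /N fineK// ge0_fin_numE// ltW.
have N_gt0 : 0 < N by rewrite -lte_fin NE.
(* By [integral_edge_dist] the normalising constant [2 * N] is the integral of [edge_dist] over the
   square. *)
pose f (x : R * R) : R := \1_unit_square x * edge_dist x / (2 * N).
have mf : measurable_fun setT f.
  by apply: measurable_funM => //; apply: measurable_funM.
have f0 x : 0 <= f x.
  rewrite /f indicE; have [xU|] := boolP (x \in unit_square); last first.
    by move=> _; rewrite !mul0r.
  rewrite mul1r divr_ge0// ?mulr_ge0 ?(ltW N_gt0)//.
  by move: xU; rewrite inE => /edge_dist_itv /andP[/ltW].
have fU : (\int[mu]_(x in unit_square) (f x)%:E = 1)%E.
  transitivity
    (\int[mu]_(x in unit_square) ((2 * N)^-1%:E * (edge_dist x)%:E))%E.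
    by apply: eq_integral => x xU; rewrite /f indicE xU mul1r mulrC EFinM.
  rewrite integralZl//; last exact: integrable_edge_dist.
  rewrite integral_edge_dist// -NE -EFinD -EFinM; congr EFin.
  by field; rewrite gt_eqF.
have E1 : density mu mf f0 setT = 1%E.
  rewrite -fU /density [RHS]integral_mkcond; apply: eq_integral => x _.
  rewrite patchE /f indicE; case: ifPn => [->//|_]; by rewrite /= !mul0r.
pose P0 : probability _ R := probability_of_measure E1.
pose nu : probability R R := distribution P0 (@edge_dist R).
have P0U : P0 unit_square = 1%E by exact: fU.
(* Change of variables in two stages: the image under [edge_dist], then the density [f]. Extending
   [g] by zero makes it measurable on the whole line. *)
have nu_ge0 (g : R -> \bar R) : measurable_fun half_itv g ->
    (forall p, half_itv p -> 0 <= g p)%E ->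
    (\int[nu]_(p in half_itv) g p =
     \int[mu]_(x in unit_square)
       (g (edge_dist x) * (edge_dist x / (2 * N))%:E))%E.
  move=> mg g0; have /(measurable_restrictT _ mhalf) mg' := mg.
  have g'0 p : (0 <= (g \_ half_itv) p)%E.
    by rewrite patchE; case: ifPn => // /set_mem; exact: g0.
  rewrite integral_mkcond ge0_integral_distribution//.
  rewrite [LHS]ge0_integral_density//; last 2 first.
  - exact: (measurableT_comp mg' mw).
  - by move=> x; exact: g'0.
  rewrite [RHS]integral_mkcond; apply: eq_integral => x _.
  rewrite /= /f [RHS]patchE indicE.
  case: ifPn => xU; last by rewrite /= !mul0r mule0.
  rewrite mul1r patchE mem_set//; move: xU; rewrite inE => /edge_dist_itv.
  by rewrite /half_itv /= in_itv.
(* For signed [g]: the weight is nonnegative, so it commutes with taking positive and negative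
   parts. *)
have nuE (g : R -> \bar R) : measurable_fun half_itv g ->
    (\int[nu]_(p in half_itv) g p =
     \int[mu]_(x in unit_square)
       (g (edge_dist x) * (edge_dist x / (2 * N))%:E))%E.
  move=> mg; rewrite (integralE nu) (integralE mu).
  rewrite nu_ge0//; last exact: measurable_funepos.
  rewrite nu_ge0//; last exact: measurable_funeneg.
  have f_ge0 x : x \in unit_square -> 0 <= edge_dist x / (2 * N).
    rewrite inE => /edge_dist_itv/andP[/ltW w0 _].
    by rewrite divr_ge0// mulr_ge0// ltW.
  congr (_ - _)%E; apply: eq_integral => x /f_ge0 ?.
    by rewrite !funeposE maxe_pMl ?mul0e ?lee_fin.
  by rewrite !funenegE -mulNe maxe_pMl ?mul0e ?lee_fin.
exists nu; split.
  apply/eqP; rewrite eq_le; apply/andP; split; first exact: probability_le1.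
  rewrite -P0U; apply: le_measure; rewrite ?inE//.
    exact: measurable_funPTI.
  by move=> x /edge_dist_itv; rewrite /half_itv /= in_itv.
move=> C d T P U V UV; rewrite (gamma_at_corner_corr nu UV).
rewrite kappaE -/N.
rewrite -[X in X / _]/(\int[mu]_(x in unit_square) copula_excess C x).
rewrite [RHS]/Rintegral nuE; last first.
  by apply/measurable_EFinP; exact: measurable_corner_corr.
rewrite -[RHS]/(Rintegral mu unit_square
   (fun x => corner_corr C (edge_dist x) * (edge_dist x / (2 * N)))).
(* The weight w / (2N) cancels the denominator 2w of the correlation, leaving (S(w) - 1) / (4N); the
   4 is absorbed by [Rintegral_corner_sum]. *)
transitivity (\int[mu]_(x in unit_square)
    ((4 * N)^-1 * (corner_sum C (edge_dist x) - 1))); last first.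
  apply: eq_Rintegral => x; rewrite inE => /edge_dist_itv/andP[w0 _].
  by rewrite /corner_corr; field; rewrite !gt_eqF.
rewrite RintegralZl//; last first.
  apply: (integrable_le_edge_dist mu_D4 mu_diag Noo (k := 2)).
    exact: measurable_corner_sum_edge_dist.
  move=> x /edge_dist_itv/andP[/ltW w0 w2].
  by apply: normr_corner_sum_le; rewrite w0.
by rewrite Rintegral_corner_sum//; field; rewrite gt_eqF.
Qed.

(** * Uniqueness *)

Section inner_flip.
Context (R : realType).

(* For uniform [x], the pair [x], [inner_flip a x] is comonotone in the tails and
   countermonotone in the centre. *)
Definition inner_flip (a x : R) : R := if a < x < 1 - a then 1 - x else x.

Lemma measurable_inner_flip a : measurable_fun setT (inner_flip a).
Proof.
apply: measurable_fun_ifT => //.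
- by apply: measurable_and; apply: measurable_fun_ltr.
- exact: measurable_funB.
Qed.

Lemma lebesgue_measure_itvc (x y : R) : x <= y ->
  lebesgue_measure `[x, y]%classic = (y - x)%:E.
Proof.
rewrite lebesgue_measure_itv/= lte_fin le_eqVlt => /predU1P[->|->//].
by rewrite ltxx subrr.
Qed.

Definition unit_lebesgue :=
  mrestr (@lebesgue_measure R) (measurable_itv `[(0:R), 1]).

HB.instance Definition _ := Measure.on unit_lebesgue.

Lemma unit_lebesgue_setT : unit_lebesgue setT = 1%E.
Proof.
by rewrite /unit_lebesgue /mrestr setTI lebesgue_measure_itvc// subr0.
Qed.

Definition flip_pair a (x : measurableTypeR R) : R * R := (x, inner_flip a x).

Lemma measurable_flip_pair a : measurable_fun setT (flip_pair a).
Proof. exact: measurable_fun_pair (measurable_inner_flip a). Qed.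

End inner_flip.

HB.instance Definition _ (R : realType) (a : R) :=
  @isMeasurableFun.Build _ _ _ _ (flip_pair a) (measurable_flip_pair a).

(** * The copula of a uniform variable and its inner flip *)

Section flip_copula.
Context (R : realType) (a : R).
Hypothesis a02 : 0 < a <= 2^-1.

Let P : probability (R * R)%type R :=
  distribution (probability_of_measure (unit_lebesgue_setT R)) (flip_pair a).

Let PE u v : P [set x | x.1 <= u /\ x.2 <= v] =
  lebesgue_measure ([set x | x <= u /\ inner_flip a x <= v] `&` `[0, 1]).
Proof. by []. Qed.

(** The flip maps the central interval to itself, so for v outside it [inner_flip a x <= v] means
    [x <= v], and the event is the interval [0, min(u, v)]. *)
Lemma flip_corner_outer u v : 0 <= u <= 1 -> 0 <= v <= 1 ->
  ~~ (a < u < 1 - a) -> ~~ (a < v < 1 - a) ->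
  P [set x | x.1 <= u /\ x.2 <= v] = (Num.min u v)%:E.
Proof.
have /andP[a0 a2] := a02; move=> /andP[u0 u1] /andP[v0 v1] ua va; rewrite PE.
rewrite (_ : _ `&` _ = `[0, Num.min u v]%classic :> set R).
  by rewrite lebesgue_measure_itvc ?subr0// le_min u0.
apply/seteqP; split => x /=; rewrite !in_itv/= le_min /inner_flip.
  move=> [[xu +] /andP[x0 x1]]; rewrite x0 xu/=.
  case: ifPn => // /andP[ax xa] xv; move: ua va; rewrite !negb_and -!leNgt.
  by move=> /orP[?|?] /orP[?|?]; lra.
move=> /andP[x0 /andP[xu xv]]; rewrite x0 xu (le_trans xu)//; do ! split => //.
case: ifPn => // /andP[ax xa]; move: ua va; rewrite !negb_and -!leNgt.
by move=> /orP[?|?] /orP[?|?]; lra.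
Qed.

(** The lower tail [0, a] lies in the event entirely, while central points need x <= u and 1 - x <=
    v, which gives the interval [1 - v, u], possibly empty. The two are disjoint because a < 1 -
    v. *)
Lemma flip_corner_inner u v : a < u < 1 - a -> a < v < 1 - a ->
  P [set x | x.1 <= u /\ x.2 <= v] = (a + Num.max 0 (u + v - 1))%:E.
Proof.
have /andP[a0 a2] := a02; move=> /andP[ua ua'] /andP[va va']; rewrite PE.
rewrite (_ : _ `&` _ =
    `[0, a]%classic `|` `[1 - v, u]%classic :> set R); last first.
  apply/seteqP; split => x /=; rewrite !in_itv/= /inner_flip.
    move=> [[xu +] /andP[x0 x1]]; case: ifPn => [/andP[ax xa] xv|+ xv].
      by right; apply/andP; split; lra.
    rewrite negb_and -!leNgt => /orP[xa|ax]; last by exfalso; lra.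
    by left; apply/andP; split; lra.
  move=> [/andP[x0 xa]|/andP[vx xu]].
    rewrite (_ : (a < x) = false)/=; last by apply/negbTE; rewrite -leNgt.
    by do ! split; try (apply/andP; split); lra.
  rewrite (_ : a < x)/=; last by lra.
  rewrite (_ : x < 1 - a)/=; last by lra.
  by do ! split; try (apply/andP; split); lra.
have UI : `[0, a]%classic `&` `[1 - v, u]%classic = set0 :> set R.
  apply/seteqP; split => x //=; rewrite !in_itv/= => -[/andP[? ?] /andP[? ?]].
  by lra.
transitivity (lebesgue_measure `[0%R, a]%classic +
  lebesgue_measure `[(1 - v)%R, u]%classic)%E.
  exact: measureU.
rewrite lebesgue_measure_itvc ?(ltW a0)// subr0 EFinD; congr (_ + _)%E.
case: (leP (1 - v) u) => h.
  rewrite lebesgue_measure_itvc//; congr EFin.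
  by case: (leP 0 (u + v - 1)) => h'; lra.
rewrite lebesgue_measure_itv/= lte_fin ltNge (ltW h)/=; congr EFin.
by case: (leP 0 (u + v - 1)) => h'; lra.
Qed.

Lemma flip_marginal1 u : 0 <= u <= 1 -> P [set x | x.1 <= u] = u%:E.
Proof.
move=> /andP[u0 u1].
rewrite -[LHS]/(lebesgue_measure ([set x | x <= u] `&` `[0, 1])).
rewrite (_ : _ `&` _ = `[0, u]%classic :> set R).
  by rewrite lebesgue_measure_itvc ?subr0.
apply/seteqP; split => x /=; rewrite !in_itv/=; first by move=> [-> /andP[->]].
by move=> /andP[-> xu]; split => //; exact: le_trans u1.
Qed.

Lemma flip_marginal2 v : 0 <= v <= 1 -> P [set x | x.2 <= v] = v%:E.
Proof.
have /andP[a0 a2] := a02; move=> v01.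
have -> : P [set x | x.2 <= v] =
    lebesgue_measure ([set x | inner_flip a x <= v] `&` `[0, 1]) by [].
(* Outside the central interval this is [flip_corner_outer] with u = 1; inside it the event is
   [0, a] together with [1 - v, 1 - a[, of total length v. *)
have [/andP[va va']|va] := boolP (a < v < 1 - a); last first.
  have h1 : 0 <= (1 : R) <= 1 by rewrite ler01 lexx.
  have h1a : ~~ (a < 1 < 1 - a).
    by rewrite negb_and -!leNgt; apply/orP; right; lra.
  have vE : v = Num.min 1 v by apply/esym/min_idPr; case/andP: v01.
  rewrite [in RHS]vE.
  rewrite -flip_corner_outer// PE; congr lebesgue_measure.
  apply/seteqP; split => x /= [] ; rewrite in_itv/=; last by move=> [].
  by move=> xv /[dup] /andP[x0 x1] ->.
have UI : `[0, a]%classic `&` `[1 - v, 1 - a[%classic = set0 :> set R.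
  apply/seteqP; split => x //=; rewrite !in_itv/= => -[/andP[? ?] /andP[? ?]].
  by lra.
transitivity (lebesgue_measure `[0%R, a]%classic +
  lebesgue_measure `[(1 - v)%R, (1 - a)%R[%classic)%E.
  rewrite -measureU//; congr lebesgue_measure.
  apply/seteqP; split => x /=; rewrite !in_itv/= /inner_flip.
    move=> [+ /andP[x0 x1]]; case: ifPn => [/andP[ax xa] xv|+ xv].
      by right; apply/andP; split; lra.
    rewrite negb_and -!leNgt => /orP[xa|ax]; last by exfalso; lra.
    by left; apply/andP; split; lra.
  move=> [/andP[x0 xa]|/andP[vx xu]].
    rewrite (_ : (a < x) = false)/=; last by apply/negbTE; rewrite -leNgt.
    by do ! split; try (apply/andP; split); lra.
  rewrite (_ : a < x)/=; last by lra.
  rewrite xu/=.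
  by do ! split; try (apply/andP; split); lra.
rewrite lebesgue_measure_itvc ?(ltW a0)// subr0 lebesgue_measure_itv/= lte_fin.
by rewrite ifT -?EFinD; [congr EFin; lra|lra].
Qed.

Definition flip_distribution (u v : R) : R :=
  fine (P [set x | x.1 <= u /\ x.2 <= v]).

Lemma is_copula_flip : is_copula flip_distribution.
Proof.
exists P; split; [|exact: flip_marginal1|exact: flip_marginal2].
move=> u v; rewrite fineK// fin_num_measure//.
by apply: measurableI; apply: measurable_le_cst.
Qed.

(** For p <= a all corners are outer and the sum is 1 + 2p, as for M. For p > a all are inner: each
    contributes a, and only the corner (1 - p, 1 - p) adds 1 - 2p. *)
Lemma corner_sum_flip p : 0 < p <= 2^-1 ->
  corner_sum flip_distribution p - 1 = 4 * Num.min p a - 2 * p.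
Proof.
have /andP[a0 a2] := a02; move=> /andP[p0 p2]; have [pa|ap] := leP p a.
  rewrite /corner_sum /flip_distribution !flip_corner_outer.
  all: rewrite ?negb_and -?leNgt.
  all: try (apply/andP; split; lra).
  all: try (apply/orP; (left; lra) || (right; lra)).
  rewrite !minxx /= (min_l (_ : p <= 1 - p)); last lra.
  rewrite (min_r (_ : p <= 1 - p)); lra.
rewrite /corner_sum /flip_distribution !flip_corner_inner.
all: try (apply/andP; split; lra).
rewrite /=.
rewrite (max_l (_ : p + p - 1 <= 0)); last lra.
rewrite (max_r (_ : 0 <= (1 - p) + (1 - p) - 1)); last lra.
rewrite (max_l (_ : p + (1 - p) - 1 <= 0)); last lra.
rewrite (max_l (_ : (1 - p) + p - 1 <= 0)); lra.
Qed.

End flip_copula.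

Lemma exists_flip_copula (R : realType) (a : R) : 0 < a <= 2^-1 ->
  exists C : copula R, forall p, 0 < p <= 2^-1 ->
    corner_corr C p = 2 * (Num.min p a / p) - 1.
Proof.
move=> a02; exists (Copula (is_copula_flip a02)) => p p02.
rewrite /corner_corr corner_sum_flip//; field.
by move: p02 => /andP[/gt_eqF ->].
Qed.

(** Interlacing distribution functions have equal left limits, so the two measures agree on open
    lower rays, a generating class closed under intersection. *)
Lemma eq_probability_le_rays (R : realType) (nu nu' : probability R R) :
  (forall a b : R, (a < b)%R ->
    nu `]-oo, a]%classic <= nu' `]-oo, b]%classic)%E ->
  (forall a b : R, (a < b)%R ->
    nu' `]-oo, a]%classic <= nu `]-oo, b]%classic)%E ->
  forall A : set R, measurable A -> nu A = nu' A.
Proof.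
have open_le (m m' : probability R R) :
    (forall a b : R, (a < b)%R ->
      m `]-oo, a]%classic <= m' `]-oo, b]%classic)%E ->
    forall x : R, (m `]-oo, x[%classic <= m' `]-oo, x[%classic)%E.
  move=> mm' x.
  have -> : `]-oo, x[%classic = \bigcup_k `]-oo, x - k.+1%:R^-1]%classic.
    rewrite -[LHS]setCK setCitvl itvcyEbigcap setC_bigcap.
    by apply: eq_bigcupr => k _; rewrite setCitvr.
  have cvm : m `]-oo, x - k.+1%:R^-1]%classic @[k --> \oo] -->
      m (\bigcup_k `]-oo, x - k.+1%:R^-1]%classic).
    apply: nondecreasing_cvg_mu => //; first exact: bigcup_measurable.
    move=> i j ij; apply/subsetPset; apply: subset_itvl.
    by rewrite bnd_simp lerB// lef_pV2 ?posrE// ler_nat.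
  rewrite -(cvg_lim _ cvm)//; apply: lime_le.
    by apply/cvg_ex; eexists; exact: cvm.
  (* The next point of the approximating sequence is strictly larger and still below [x]. *)
  apply: nearW => k; apply: (le_trans (mm' _ (x - k.+2%:R^-1) _)).
    by rewrite ltrD2l ltrN2 ltf_pV2 ?posrE// ltr_nat.
  apply: le_measure; rewrite ?inE//; first exact: bigcup_measurable.
  by move=> y hy; exists k.+1.
move=> h h'.
apply: (measure_unique (@RGenInftyO.G R) (fun k => `]-oo, k%:R[%classic)).
- exact: RGenInftyO.measurableE.
- move=> _ _ [x ->] [y ->]; exists (Num.min x y).
  by apply/seteqP; split => z /=; rewrite !in_itv/= lt_min;
    [move=> [-> ->]|move=> /andP].
- by move=> k; exists k%:R.
- apply/seteqP; split => // x _; exists (Num.truncn x).+1 => //=.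
  by rewrite in_itv/= truncnS_gt.
- by move=> _ [x ->]; apply/eqP; rewrite eq_le !open_le.
- by move=> k; rewrite (le_lt_trans (probability_le1 _ _)) ?ltry.
Qed.

Lemma copula_random_vector (R : realType) (C : copula R) :
  exists P : probability (R * R)%type R, has_copula P fst snd C.
Proof.
have [P [CE P1 P2]] := copulaP C; exists P; split => //.
Qed.

Lemma half_itvE (R : realType) (p : R) : half_itv p <-> 0 < p <= 2^-1.
Proof. by rewrite /half_itv /= in_itv. Qed.

(* The combination of the correlations of two flip copulas that approximates
   the indicator of (0, a] as [b] decreases to [a]. *)
Definition ramp (R : realType) (a b p : R) : R :=
  (b * (Num.min p a / p) - a * (Num.min p b / p)) / (b - a).

(** min(p, a) / p is 1 up to a and a / p beyond. The ramp is therefore 1 for p <= a and 0 for p >=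
    b, where b(a / p) and a(b / p) cancel. *)
Lemma ramp_bounds (R : realType) (a b p : R) : 0 < a < b -> 0 < p ->
  (p <= a)%R%:R <= ramp a b p <= (p <= b)%R%:R.
Proof.
move=> /andP[a0 ab] p0; rewrite /ramp; have ba : 0 < b - a by lra.
have [pa|pa] := leP p a; have [pb|pb] := leP p b;
  rewrite ?divff ?gt_eqF//; try (exfalso; lra).
- by rewrite !mulr1 divff ?gt_eqF// lexx.
- have bp : 1 <= b / p by rewrite ler_pdivlMr ?mul1r.
  have ap : a / p <= 1 by rewrite ler_pdivrMr ?mul1r ?ltW.
  rewrite mulr1 ler_pdivlMr// ler_pdivrMr// mul0r mul1r lerD2r.
  rewrite ler_piMr ?andbT//; last lra.
  rewrite (_ : b * (a / p) = a * (b / p)) ?subr_ge0 ?ler_peMr ?(ltW a0)//.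
  by ring.
- by rewrite (_ : b * (a / p) - a * (b / p) = 0) ?mul0r ?lexx//; ring.
Qed.

(** * Comparison of two representing measures *)

Section uniqueness.
Context (R : realType) (kappa : copula R -> R).

(** The middle term is the [nu]-integral of the ramp, yet it involves only [kappa]; it can therefore
    be compared across different representing measures. *)
Lemma gamma_represents_ramp (nu : probability R R) (a b : R)
    (Ca Cb : copula R) :
  gamma_represents nu kappa -> 0 < a < b -> b <= 2^-1 ->
  (forall p, 0 < p <= 2^-1 -> corner_corr Ca p = 2 * (Num.min p a / p) - 1) ->
  (forall p, 0 < p <= 2^-1 -> corner_corr Cb p = 2 * (Num.min p b / p) - 1) ->
  (nu `]-oo, a]%classic <=
    (((b * kappa Ca - a * kappa Cb) / (b - a) + 1) / 2)%:E <=
    nu `]-oo, b]%classic)%E.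
Proof.
move=> [nu1 nuE] ab b2 CaE CbE.
have mhalf : measurable (@half_itv R) by exact: measurable_itv.
have kE (C : copula R) : kappa C = \int[nu]_(p in half_itv) corner_corr C p.
  have [P PC] := copula_random_vector C.
  by rewrite (nuE _ _ _ _ _ _ PC) (gamma_at_corner_corr _ PC).
have iC (C : copula R) : nu.-integrable half_itv (EFin \o corner_corr C).
  apply: measurable_bounded_integrable => //.
  - by rewrite (le_lt_trans (probability_le1 _ _)) ?ltry.
  - exact: measurable_corner_corr.
  exists 1; split => // M M1 p /half_itvE /andP[p0 p2].
  apply: (le_trans _ (ltW M1)); rewrite /corner_corr normrM normfV.
  have p20 : 0 < 2 * p by lra.
  rewrite (gtr0_norm p20) ler_pdivrMr// mul1r normr_corner_sum_le//.
  by rewrite (ltW p0).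
have ba : 0 < b - a by case/andP: ab => _; rewrite subr_gt0.
(* The ramp as a combination of the correlations 2 min(p, a) / p - 1 and 2 min(p, b) / p - 1; the
   final [2^-1] compensates the two terms -1. *)
pose g p := b / (2 * (b - a)) * corner_corr Ca p -
  a / (2 * (b - a)) * corner_corr Cb p + 2^-1.
have gE p : half_itv p -> g p = ramp a b p.
  move=> /half_itvE p02; rewrite /g CaE// CbE// /ramp; field.
  by move: p02 => /andP[/gt_eqF -> _]; rewrite gt_eqF.
have iZ (k : R) (C : copula R) :
    nu.-integrable half_itv (EFin \o (fun p => k * corner_corr C p)).
  exact: (integrableZl mhalf k (iC C)).
have i2 : nu.-integrable half_itv (EFin \o (cst 2^-1 : R -> R)).
  exact: finite_measure_integrable_cst.
have iB := integrableB mhalf (iZ (b / (2 * (b - a))) Ca)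
  (iZ (a / (2 * (b - a))) Cb).
have ig : nu.-integrable half_itv (EFin \o g).
  exact: (integrableD mhalf iB i2).
have -> : ((b * kappa Ca - a * kappa Cb) / (b - a) + 1) / 2 =
    \int[nu]_(p in half_itv) g p.
  rewrite (RintegralD mhalf iB i2) (RintegralB mhalf (iZ _ _) (iZ _ _)).
  rewrite !RintegralZl// -!kE Rintegral_cst//.
  have -> : fine (nu half_itv) = 1 := congr1 fine nu1.
  by field; rewrite gt_eqF.
rewrite /Rintegral fineK ?integrable_fin_num//.
have muI x : nu `]-oo, x]%classic =
    (\int[nu]_(p in half_itv) ((p <= x)%R%:R)%:E)%E.
  rewrite (probability_setI1 _ mhalf nu1)// -integral_indic//.
  apply: eq_integral => p _; rewrite indicE; congr (nat_of_bool _)%:R%:E.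
  by apply/idP/idP; rewrite inE /= in_itv.
have mle x : measurable_fun half_itv (fun p : R => ((p <= x)%R%:R : R)%:E).
  apply: measurable_funTS; apply/measurable_EFinP.
  rewrite (_ : (fun _ => _) = \1_[set p : R | p <= x]).
    by apply: measurable_indic; exact: measurable_le_cst.
  apply/funext => p; rewrite indicE; congr (nat_of_bool _)%:R.
  by apply/idP/idP; rewrite inE.
have bnd p : half_itv p -> (p <= a)%R%:R <= g p <= (p <= b)%R%:R.
  move=> hp; rewrite gE//; apply: ramp_bounds => //.
  by move/half_itvE : hp => /andP[].
have mg := measurable_int _ ig.
rewrite !muI; apply/andP; split; apply: ge0_le_integral => //.
- by move=> p /bnd/andP[? _]; rewrite lee_fin.
- by move=> p /bnd/andP[/(le_trans _) g0 _]; rewrite lee_fin g0.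
- by move=> p /bnd/andP[_ ?]; rewrite lee_fin.
Qed.

Lemma gamma_represents_unique (nu nu' : probability R R) :
  gamma_represents nu kappa -> gamma_represents nu' kappa ->
  forall A : set R, measurable A -> nu A = nu' A.
Proof.
have mhalf : measurable (@half_itv R) by exact: measurable_itv.
have le_rays (m m' : probability R R) :
    gamma_represents m kappa -> gamma_represents m' kappa ->
    forall a b : R, a < b -> (m `]-oo, a]%classic <= m' `]-oo, b]%classic)%E.
  (* Since both measures are carried by (0, 1/2], the left side is 0 when a <= 0 and the right side
     is 1 when b > 1/2. Otherwise the common middle term of [gamma_represents_ramp] separates the
     two sides. *)
  move=> mk m'k a b ab; have [a0|a0] := leP a 0.
    rewrite (probability_setI1 _ mhalf mk.1)//.
    rewrite (_ : _ `&` _ = set0) ?measure0//; apply/seteqP; split => p //=.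
    by rewrite /half_itv /= !in_itv/= => -[pa /andP[p0 _]]; lra.
  have [b2|b2] := leP b 2^-1; last first.
    rewrite (@le_trans _ _ 1%E) ?probability_le1//.
    rewrite -m'k.1; apply: le_measure; rewrite ?inE// => p.
    by rewrite /half_itv /= !in_itv/= => /andP[_ p2]; lra.
  have a02 : 0 < a <= 2^-1 by rewrite a0 (le_trans (ltW ab)).
  have b02 : 0 < b <= 2^-1 by rewrite (lt_trans a0).
  have [Ca CaE] := exists_flip_copula a02.
  have [Cb CbE] := exists_flip_copula b02.
  have ab0 : 0 < a < b by rewrite a0.
  have /andP[m1 _] := gamma_represents_ramp mk ab0 b2 CaE CbE.
  have /andP[_ m2] := gamma_represents_ramp m'k ab0 b2 CaE CbE.
  exact: le_trans m1 m2.
by move=> h h'; apply: eq_probability_le_rays; exact: le_rays.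
Qed.
End uniqueness.

Theorem theorem3 (R : realType) (kappa : copula R -> R)
    (hkappa : generalized_gini kappa) :
  exists nu : probability R R,
    gamma_represents nu kappa /\
    forall nu' : probability R R, gamma_represents nu' kappa ->
      forall A : set R, measurable A -> nu' A = nu A.
Proof.
have [nu nu_kappa] := gini_gamma_exists hkappa.
exists nu; split => // nu' nu'_kappa.
exact: gamma_represents_unique nu'_kappa nu_kappa.
Qed.
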